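(* Let $C$ be the cover in a valid inequality $\sum_{j\in C}x_j\leq\beta$ for the knapsack polytope, as described in the context, and consider $\gamma:=|C|$ to be even. 1. If $\beta=\gamma-1$, then the sum of all inequalities in SCILS is equivalent to CILS. Therefore, in this case, the set of inequalities in SCILS dominates CILS. 2. If $\beta<\gamma-1$, there is no dominance relation between SCILS and CILS.
   Context: Let $N=\{1,\ldots,n\}$, let $w\in\mathbb{Z}^n$ have positive entries, and let $c$ be a positive integer with $c\geq w_i$ for all $i\in N$. The knapsack polytope is the convex hull of $\{x\in\{0,1\}^n : w^Tx\leq c\}$. A set $C\subseteq N$ is a cover if $\sum_{j\in C}w_j>c$. Let $C\subset N$ and let $\beta$ be an integer with $1<\beta<|C|$ such that the inequality $\sum_{j\in C}x_j\leq\beta$ is valid for the knapsack polytope (so $C$ is a cover). $\mathbb{S}^n$ is the set of real symmetric $n\times n$ matrices; the variable $X\in\mathbb{S}^n$ represents the lifting $X:=xx^T$ and is entrywise nonnegative. The cover inequality in the lifted space (CILS) derived from $\sum_{j\in C}x_j\leq\beta$ is $$\sum_{i,j\in C,\ i<j}X_{ij}\leq\binom{\beta}{2}.$$ For $|C|$ even, the set of cover inequalities in the lifted space (SCILS) derived from $\sum_{j\in C}x_j\leq\beta$ consists of all inequalities $$\sum_{(i,j)\in C_s}X_{ij}\leq\left\lfloor\frac{\beta}{2}\right\rfloor,$$ where $C_s=\{(i_1,j_1),\ldots,(i_p,j_p)\}$, with $i_k<j_k$ for all $k=1,\ldots,p$, ranges over all partitions of $C$ into pairs. Two inequalities are equivalent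 if one is a positive scalar multiple of the other. A set of inequalities dominates another if every entrywise nonnegative $X\in\mathbb{S}^n$ satisfying all inequalities of the first set also satisfies all inequalities of the second. There is no dominance relation between two sets of inequalities if neither dominates the other.
   Formalization: In part 2, for β = 2 only ''SCILS does not dominate CILS'' is claimed; full ''no dominance relation'' is stated for 2 < β < γ−1, since for β = 2 both right-hand sides equal 1 and CILS dominates SCILS, so the printed claim is false there. *)

(* Defs.v *)
From HB Require Import structures.
From mathcomp Require Import all_boot all_order all_algebra.
From mathcomp Require Import boolp classical_sets fsbigop reals.
From mathcomp Require Import convex.

Set Implicit Arguments.
Unset Strict Implicit.
Unset Printing Implicit Defensive.

Import Order.TTheory GRing.Theory Num.Theory.

Local Open Scope classical_set_scope.
Local Open Scope ring_scope.

Definition knapsack_points (R : realType) (n : nat) (w : 'cV[int]_n) (c : int)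
    : set 'cV[R]_n :=
  [set x : 'cV[R]_n | (forall i, x i 0 = 0 \/ x i 0 = 1) /\
           ((map_mx intr w)^T *m x) 0 0 <= c%:~R].

Definition convex_hull (R : realType) (V : lmodType R) (A : set V) : set V :=
  smallest (@convex_set R V) A.

Definition knapsack_polytope (R : realType) (n : nat) (w : 'cV[int]_n)
    (c : int) : set 'cV[R]_n :=
  convex_hull (@knapsack_points R n w c).

(* The pair (A, b) stands for the inequality
   \sum_i \sum_j A i j * X i j <= b in the matrix variable X.  Below, A is always
   strictly upper triangular, so the coefficients of an inequality in symmetric X
   are unambiguous.  Sums and multiples of inequalities are those of the product
   module; R^o is R as a module over itself. *)
Definition lineq (R : realType) (n : nat) := ('M[R]_n * R^o)%type.

Definition satisfies (R : realType) (n : nat) (X : 'M[R]_n) (q : lineq R n) :=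
  \sum_i \sum_j q.1 i j * X i j <= q.2.

Definition equivalent (R : realType) (n : nat) (q r : lineq R n) :=
  exists2 k : R, 0 < k & q = k *: r.

Definition dominates (R : realType) (n : nat) (S T : set (lineq R n)) :=
  forall X : 'M[R]_n, X^T = X -> (forall i j, 0 <= X i j) ->
    (forall q, S q -> satisfies X q) -> forall q, T q -> satisfies X q.

Definition no_dominance (R : realType) (n : nat) (S T : set (lineq R n)) :=
  ~ dominates S T /\ ~ dominates T S.

(* \sum_((i, j) in P) X i j <= b *)
Definition pair_ineq (R : realType) (n : nat) (P : {set 'I_n * 'I_n}) (b : R)
    : lineq R n :=
  (\matrix_(i, j) ((i, j) \in P)%:R, b).

Definition CILS (R : realType) (n : nat) (C : {set 'I_n}) (beta : nat)
    : lineq R n :=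
  pair_ineq
    [set p : 'I_n * 'I_n | [&& p.1 \in C, p.2 \in C & (p.1 < p.2)%N]]%SET
    'C(beta, 2)%:R.

(* P is a set {(i_1, j_1), ..., (i_p, j_p)} with i_k < j_k whose underlying
   unordered pairs {i_k, j_k} form a partition of C. *)
Definition pair_partition (n : nat) (C : {set 'I_n}) (P : {set 'I_n * 'I_n}) :=
  [forall p in P, (p.1 < p.2)%N] &&
  finset.partition [set [set p.1; p.2] | p in P]%SET C.

Definition SCILS (R : realType) (n : nat) (C : {set 'I_n}) (beta : nat)
    : set (lineq R n) :=
  [set pair_ineq P (beta./2)%:R | P in [set P | pair_partition C P]].
Arguments SCILS R {n} C beta _.

(* For beta = 2 both kinds of inequalities have right-hand side 1, and every
   left-hand side in SCILS is a subsum of that of CILS. *)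
Lemma CILS_dominates_SCILS2 (R : realType) (n : nat) (C : {set 'I_n}) :
  dominates [set CILS R C 2] (SCILS R C 2).
Proof.
move=> X _ X0 /(_ _ erefl) hC q [P /= /andP[/'forall_implyP ltP partP] <-].
rewrite /satisfies /= in hC *.
apply: le_trans hC; apply: ler_sum => i _; apply: ler_sum => j _.
rewrite !mxE ler_wpM2r// ler_nat.
have [ijP|//] := boolP ((i, j) \in P).
have inC x : x \in [set i; j]%SET -> x \in C.
  move=> xij; rewrite -(cover_partition partP).
  by apply/finset.bigcupP; exists [set i; j]%SET => //; apply/imsetP; exists (i, j).
by rewrite !inE /= !inC ?inE ?eqxx ?orbT//= (ltP (i, j)).
Qed.

(* Main.v *)
Require Import Defs.
From mathcomp Require Import all_boot all_order all_algebra perm.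
From mathcomp Require Import zify.
From mathcomp Require Import boolp classical_sets fsbigop reals.
From mathcomp Require Import fintype finset.

Import Order.TTheory GRing.Theory Num.Theory.

(** Write g for the even cardinal of C and h for the integer part of beta / 2.
    The inequalities in SCILS correspond to the perfect matchings of the
    complete graph on C, each bounding the sum of X over the g / 2 edges of a
    matching by h, while CILS bounds the sum of X over all the edges by the
    binomial coefficient of beta and 2.

    The symmetric group of C acts transitively on the edges and permutes the
    matchings, so every edge lies in the same number k of matchings
    ([card_matchings_with]).  Counting the pairs (edge, matching through it) in
    two ways shows that there are (g - 1) k matchings
    ([matchings_double_count]).  Hence the sum of all the inequalities in SCILS
    is k times the inequality bounding the sum of X over all the edges by
    (g - 1) h ([sum_matching_ineq]), and k > 0 because matchings exist.

    If beta = g - 1, then beta is odd, so (g - 1) h = beta (beta - 1) / 2 and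
    this inequality is CILS itself.

    If beta < g - 1, then (g - 1) h exceeds the right-hand side of CILS
    ([bin2_lt_half_mul]).  The matrix with all entries equal to h / (g / 2)
    makes every inequality in SCILS, and therefore their sum, tight, so it
    violates CILS ([SCILS_not_dominates]).

    Conversely, CILS allows a single edge to carry its whole right-hand side.
    For beta > 2 this is more than h, which violates the inequality of any
    matching through that edge ([CILS_not_dominates]). *)

(** * Perfect matchings of a finite set *)

Definition matchings {T : finType} (C : {set T}) : {set {set {set T}}} :=
  [set Q | finset.partition Q C & [forall B in Q, #|B| == 2]].

Definition matchings_with {T : finType} (C e : {set T}) :=
  [set Q in matchings C | e \in Q].

Lemma matchingsP {T : finType} (C : {set T}) (Q : {set {set T}}) :
  reflect (finset.partition Q C /\ {in Q, forall B : {set T}, #|B| = 2})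
    (Q \in matchings C).
Proof.
rewrite inE; apply: (iffP andP) => -[partQ cardQ]; split=> //.
  by move=> B QB; apply/eqP; apply: (forall_inP cardQ).
by apply/forall_inP => B QB; rewrite cardQ.
Qed.

Lemma card_matching {T : finType} (C : {set T}) (Q : {set {set T}}) :
  Q \in matchings C -> #|Q| = #|C|./2.
Proof.
move=> /matchingsP[partQ cardQ].
by rewrite (card_uniform_partition cardQ partQ) muln2 doubleK.
Qed.

(** Pair off two elements of C and match the rest by induction. *)
Lemma matching_exists {T : finType} (C : {set T}) :
  ~~ odd #|C| -> exists Q, Q \in matchings C.
Proof.
have [k] := ubnP #|C|; elim: k C => // k IHk C leCk evenC.
have [->|/set0Pn[x xC]] := eqVneq C set0.
  exists set0; apply/matchingsP; split; first by rewrite partition_set0.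
  by move=> B; rewrite inE.
have C1 : #|C| = #|C :\ x|.+1 by rewrite (cardsD1 x) xC.
have /set0Pn[y yC] : C :\ x != set0.
  by apply: contraNneq evenC => D0; rewrite C1 D0 cards0.
set D := C :\ x :\ y.
have C2 : #|C| = #|D|.+2 by rewrite C1 (cardsD1 y) yC.
have [||Q /matchingsP[partQ cardQ]] := IHk D.
- by move: leCk; rewrite C2 ltnS => /ltnW.
- by move: evenC; rewrite C2 /= negbK.
exists ([set x; y] |: Q); apply/matchingsP; split; last first.
  move=> B /setU1P[->|/cardQ//].
  by move: yC; rewrite cards2 !inE eq_sym => /andP[->].
have -> : C = [set x; y] :|: D.
  by rewrite /D -setUA setD1K ?setD1K.
apply: partitionU1 => //; first by apply/set0Pn; exists x; rewrite !inE eqxx.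
by rewrite -setI_eq0; apply/eqP/setP => z; rewrite !inE; do 2 case: eqP.
Qed.

Lemma leq_card_matchings_with {T : finType} (C e : {set T}) (s : {perm T}) :
  #|matchings_with C e| <= #|matchings_with (s @: C) (s @: e)|.
Proof.
pose f (Q : {set {set T}}) := [set s @: (B : {set T}) | B in Q].
have inj_f : injective f by apply/imset_inj/imset_inj/perm_inj.
rewrite -(card_imset _ inj_f); apply: subset_leq_card.
apply/subsetP => _ /imsetP[Q + ->].
move=> /setIdP[/matchingsP[partQ cardQ] eQ].
apply/setIdP; split; last exact: imset_f.
apply/matchingsP; split; first by rewrite imset_partition//; apply: perm_inj.
by move=> _ /imsetP[B QB ->]; rewrite card_imset ?cardQ//; apply: perm_inj.
Qed.

(** The symmetric group of C is 2-transitive; a product of two transpositions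
    of elements of C suffices. *)
Lemma pair_transitive {T : finType} {C e e' : {set T}} :
    e \subset C -> e' \subset C -> #|e| = 2 -> #|e'| = 2 ->
  exists2 s : {perm T}, s @: C = C & s @: e = e'.
Proof.
move=> eC e'C /eqP/cards2P[a [b [ab eE]]] /eqP/cards2P[a' [b' [a'b' e'E]]].
move: eC e'C; rewrite eE e'E !subUset !sub1set => /andP[aC bC] /andP[a'C b'C].
have tpermC x y : x \in C -> y \in C -> perm_on C (tperm x y).
  move=> xC yC; apply: subset_trans (tperm_on x y) _.
  by rewrite subUset !sub1set xC.
(* The first transposition moves b to b1, which differs from a', so the second
   one can send b1 to b' while fixing a'. *)
set b1 := tperm a a' b.
have b1C : b1 \in C by rewrite perm_closed// tpermC.
exists (tperm a a' * tperm b1 b')%g.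
  by apply/im_perm_on/perm_onM; apply: tpermC.
rewrite imsetU1 imset_set1 !permM tpermL -/b1 tpermL tpermD//.
  by rewrite -[X in _ != X](tpermL a a') (inj_eq perm_inj) eq_sym.
by rewrite eq_sym.
Qed.

(** Permutations of C carry the matchings through one edge to those through any
    other edge. *)
Lemma card_matchings_with {T : finType} (C e e' : {set T}) :
    e \subset C -> e' \subset C -> #|e| = 2 -> #|e'| = 2 ->
  #|matchings_with C e| = #|matchings_with C e'|.
Proof.
have le_with (d d' : {set T}) :
    d \subset C -> d' \subset C -> #|d| = 2 -> #|d'| = 2 ->
    #|matchings_with C d| <= #|matchings_with C d'|.
  move=> dC d'C d2 d'2; have [s sC <-] := pair_transitive dC d'C d2 d'2.
  by rewrite -[in X in _ <= X]sC leq_card_matchings_with.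
by move=> *; apply/eqP; rewrite eqn_leq !le_with.
Qed.

(** Both sides, multiplied by [#|C|./2], count the pairs of a matching and an
    edge in it: a matching has [#|C|./2] edges, and there are
    [#|C|./2 * #|C|.-1] edges, all in equally many matchings. *)
Lemma matchings_double_count {T : finType} (C e : {set T}) :
    ~~ odd #|C| -> e \subset C -> #|e| = 2 ->
  #|matchings C| = #|C|.-1 * #|matchings_with C e|.
Proof.
move=> evenC eC e2.
have C2 : 1 < #|C| by rewrite -e2 subset_leq_card.
have half_gt0 : 0 < #|C|./2 by rewrite half_gt0.
have draws_eq : #|[set B : {set T} | B \subset C & #|B| == 2]| = #|C|./2 * #|C|.-1.
  by rewrite cards_draws bin2 -{1}(even_halfK evenC) -doubleMl doubleK.
have : \sum_(Q in matchings C) #|Q|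
     = \sum_(B : {set T} | (B \subset C) && (#|B| == 2)) #|matchings_with C B|.
  under eq_bigr => Q _ do rewrite -sum1_card.
  rewrite (exchange_big_dep (fun B : {set T} => (B \subset C) && (#|B| == 2))) /=.
    apply: eq_bigr => B _; rewrite -sum1_card; apply: eq_bigl => Q.
    by rewrite !inE.
  move=> Q B /matchingsP[partQ cardQ] QB.
  by rewrite (partitionS partQ QB) cardQ.
rewrite (eq_bigr (fun=> #|C|./2)) => [|Q /card_matching //].
rewrite [RHS](eq_bigr (fun=> #|matchings_with C e|)); last first.
  by move=> B /andP[BC /eqP B2]; apply: card_matchings_with.
rewrite sum_nat_const sum_nat_cond_const -cardsE draws_eq mulnC -mulnA.
by move/eqP; rewrite eqn_pmul2l// => /eqP.
Qed.

(** * Matchings as sets of increasing pairs *)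

Definition edge {n} (p : 'I_n * 'I_n) : {set 'I_n} := [set p.1; p.2].

(** Choosing the increasing representative of each edge translates matchings
    into the sets of ordered pairs that index the inequalities of SCILS. *)
Definition oriented {n} (Q : {set {set 'I_n}}) : {set 'I_n * 'I_n} :=
  [set p : 'I_n * 'I_n | (p.1 < p.2) && (edge p \in Q)].

Definition increasing_pairs {n} (C : {set 'I_n}) : {set 'I_n * 'I_n} :=
  [set p : 'I_n * 'I_n | [&& p.1 \in C, p.2 \in C & p.1 < p.2]].

Lemma edge_inj n (p q : 'I_n * 'I_n) :
  p.1 < p.2 -> q.1 < q.2 -> edge p = edge q -> p = q.
Proof.
case: p q => [a b] [c d] /= ab cd /setP E.
have := E a; have := E b; have := E c; have := E d.
rewrite !inE /= !eqxx /= ?orbT -!val_eqE /= => h1 h2 h3 h4.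
by congr pair; apply: val_inj => /=; lia.
Qed.

Lemma card_edge n (p : 'I_n * 'I_n) : p.1 < p.2 -> #|edge p| = 2.
Proof. by move=> lt_p; rewrite cards2 -val_eqE /= ltn_eqF. Qed.

Lemma exists_edge n (B : {set 'I_n}) :
  #|B| = 2 -> exists2 p : 'I_n * 'I_n, p.1 < p.2 & edge p = B.
Proof.
move=> /eqP/cards2P[x [y [+ ->]]]; rewrite -val_eqE neq_ltn => /orP[xy|yx].
  by exists (x, y).
by exists (y, x) => //; rewrite /edge setUC.
Qed.

Lemma edges_oriented n (Q : {set {set 'I_n}}) :
  {in Q, forall B : {set 'I_n}, #|B| = 2} -> edge @: oriented Q = Q.
Proof.
move=> cardQ; apply/setP => B; apply/imsetP/idP => [[p + ->]|QB].
  by rewrite inE => /andP[].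
have [p lt_p pB] := exists_edge _ _ (cardQ B QB).
by exists p; rewrite // inE lt_p pB.
Qed.

Lemma oriented_edges n (P : {set 'I_n * 'I_n}) :
  {in P, forall p : 'I_n * 'I_n, p.1 < p.2} -> oriented (edge @: P) = P.
Proof.
move=> ltP; apply/setP => p; rewrite inE; apply/andP/idP => [[lt_p]|Pp].
  by case/imsetP => q Pq /edge_inj ->//; apply: ltP.
by rewrite ltP// imset_f.
Qed.

Lemma card_oriented n (Q : {set {set 'I_n}}) :
  {in Q, forall B : {set 'I_n}, #|B| = 2} -> #|oriented Q| = #|Q|.
Proof.
move=> cardQ; rewrite -[in RHS](edges_oriented _ _ cardQ) card_in_imset//.
by move=> p q; rewrite !inE => /andP[lt_p _] /andP[lt_q _]; apply: edge_inj.
Qed.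

Lemma oriented_inj n (C : {set 'I_n}) : {in matchings C &, injective oriented}.
Proof.
move=> Q Q' /matchingsP[_ cardQ] /matchingsP[_ cardQ'] eqQ.
by rewrite -(edges_oriented _ _ cardQ) eqQ edges_oriented.
Qed.

Lemma pair_partitionP n (C : {set 'I_n}) (P : {set 'I_n * 'I_n}) :
  reflect (exists2 Q, Q \in matchings C & P = oriented Q) (pair_partition C P).
Proof.
apply: (iffP andP) => [[/forall_inP ltP partP]|[Q /matchingsP[partQ cardQ] ->]].
  exists (edge @: P); last by rewrite oriented_edges.
  by apply/matchingsP; split=> // _ /imsetP[p Pp ->]; apply/card_edge/ltP.
split; first by apply/forall_inP => p; rewrite inE => /andP[].
by rewrite (edges_oriented _ _ cardQ : [set [set p.1; p.2] | p in _] = Q).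
Qed.

Lemma increasing_pairsE n (C : {set 'I_n}) :
  increasing_pairs C = oriented [set B : {set 'I_n} | B \subset C & #|B| == 2].
Proof.
apply/setP => p; rewrite !inE subUset !sub1set.
by case: ltnP => [lt_p|]; rewrite ?andbF// card_edge ?eqxx ?andbT.
Qed.

Lemma card_increasing_pairs n (C : {set 'I_n}) :
  #|increasing_pairs C| = 'C(#|C|, 2).
Proof.
rewrite increasing_pairsE card_oriented ?cards_draws//.
by move=> B; rewrite inE => /andP[_ /eqP].
Qed.

Lemma oriented_subset n (C : {set 'I_n}) Q :
  Q \in matchings C -> oriented Q \subset increasing_pairs C.
Proof.
move=> /matchingsP[partQ cardQ]; rewrite increasing_pairsE.
apply/subsetP => p; rewrite !inE => /andP[-> Qp] /=.
by rewrite (partitionS partQ Qp) (cardQ _ Qp).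
Qed.

Lemma card_oriented_matching n (C : {set 'I_n}) Q :
  Q \in matchings C -> #|oriented Q| = #|C|./2.
Proof.
by move=> QC; rewrite -(card_matching _ _ QC) card_oriented//; case/matchingsP: QC.
Qed.

(** * Linear inequalities in the lifted variable *)

Local Open Scope classical_set_scope.
Local Open Scope ring_scope.

Section Satisfies.
Variables (R : realType) (n : nat) (X : 'M[R]_n).

Lemma satisfies_pair_ineq (P : {set 'I_n * 'I_n}) (b : R) :
  satisfies X (pair_ineq P b) <-> \sum_(p in P) X p.1 p.2 <= b.
Proof.
rewrite /satisfies /= pair_big /= [in X in _ <-> X]big_mkcond /=.
suff -> : \sum_(p : 'I_n * 'I_n)
    (\matrix_(i, j) ((i, j) \in P)%:R : 'M[R]_n) p.1 p.2 * X p.1 p.2 =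
  \sum_(p : 'I_n * 'I_n) (if p \in P then X p.1 p.2 else 0) by [].
by apply: eq_bigr => -[i j] _; rewrite mxE /=; case: ifP; rewrite ?mul1r ?mul0r.
Qed.

Lemma satisfiesZ (k : R) (q : lineq R n) :
  0 < k -> satisfies X (k *: q) <-> satisfies X q.
Proof.
move=> k_gt0; rewrite /satisfies /=.
under eq_bigr => i _ do
  (under eq_bigr => j _ do rewrite mxE -mulrA; rewrite -mulr_sumr).
by rewrite -mulr_sumr ler_pM2l.
Qed.

(** Inequalities satisfied by X form a convex cone: with [satisfiesZ], this is
    why a set of inequalities dominates any inequality equivalent to its sum. *)
Lemma satisfies_sum (I : finType) (A : {pred I}) (F : I -> lineq R n) :
  (forall i, i \in A -> satisfies X (F i)) -> satisfies X (\sum_(i in A) F i).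
Proof.
move=> satF; apply: (big_ind (satisfies X)) => //; rewrite /satisfies /=.
  by rewrite big1// => i _; rewrite big1// => j _; rewrite mxE mul0r.
move=> q r; under [in X in _ -> _ -> X]eq_bigr => i _ do
  (under eq_bigr => j _ do rewrite mxE mulrDl; rewrite big_split).
by rewrite big_split; apply: lerD.
Qed.

End Satisfies.

(** The sum over SCILS ranges over a set of inequalities: injectivity ensures
    that distinct matchings contribute distinct summands. *)
Lemma pair_ineq_inj (R : realType) (n : nat) (b : R) :
  injective (fun P : {set 'I_n * 'I_n} => pair_ineq P b).
Proof.
move=> P P' [/matrixP eqPP']; apply/setP => -[i j].
have /eqP := eqPP' i j; rewrite !mxE eqr_nat.
by case: (_ \in P); case: (_ \in P').
Qed.

Definition matching_ineq {R : realType} {n : nat} (b : R)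
  (Q : {set {set 'I_n}}) : lineq R n := pair_ineq (oriented Q) b.

Lemma SCILS_matchings (R : realType) (n : nat) (C : {set 'I_n}) (beta : nat) :
  SCILS R C beta = matching_ineq (beta./2)%:R @` [set` matchings C].
Proof.
apply/seteqP; split=> [_ [P /pair_partitionP[Q QC ->] <-]|_ [Q QC <-]].
  by exists Q.
by exists (oriented Q) => //; apply/pair_partitionP; exists Q.
Qed.

Lemma sum_SCILS (R : realType) (n : nat) (C : {set 'I_n}) (beta : nat) :
  \sum_(q \in SCILS R C beta) q =
  \sum_(Q in matchings C) matching_ineq (beta./2)%:R Q.
Proof.
rewrite SCILS_matchings fsbig_image; last first.
  move=> Q Q' /set_mem QC /set_mem Q'C /pair_ineq_inj.
  exact: (oriented_inj _ C _ _ QC Q'C).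
by rewrite [RHS]bigfs ?index_enum_uniq// => Q _; rewrite mem_index_enum.
Qed.

(** The coefficient of X i j in the sum is the number k of matchings through the
    edge {i, j}, which does not depend on the edge, and the right-hand side is b
    times the number [#|C|.-1 * k] of matchings. *)
Lemma sum_matching_ineq (R : realType) (n : nat) (C : {set 'I_n}) (b : R) :
    ~~ odd #|C| -> (1 < #|C|)%N ->
  exists2 k : R, 0 < k & \sum_(Q in matchings C) matching_ineq b Q =
    k *: pair_ineq (increasing_pairs C) (b * (#|C|.-1)%:R).
Proof.
move=> evenC C_gt1.
have [p pC] : exists p, p \in increasing_pairs C.
  by apply/set0Pn; rewrite -card_gt0 card_increasing_pairs bin_gt0.
set k := #|matchings_with C (edge p)|.
have incrP (q : 'I_n * 'I_n) : q \in increasing_pairs C ->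
    edge q \subset C /\ #|edge q| = 2%N.
  by rewrite inE subUset !sub1set => /and3P[-> -> /card_edge].
have [pC' p2] := incrP p pC.
have cardM : #|matchings C| = (#|C|.-1 * k)%N by apply: matchings_double_count.
have k_gt0 : (0 < k)%N.
  have [Q QC] := matching_exists C evenC.
  have : (0 < #|matchings C|)%N by apply/card_gt0P; exists Q.
  by rewrite cardM muln_gt0 => /andP[].
exists k%:R; first by rewrite ltr0n.
apply: injective_projections => /=; last first.
  rewrite (big_morph (fun q : lineq R n => q.2) (id1 := 0) (op1 := +%R))//=.
  by rewrite sumr_const cardM mulrnA scaler_nat mulr_natr.
rewrite (big_morph (fun q : lineq R n => q.1) (id1 := 0) (op1 := +%R))//=.
apply/matrixP => i j; rewrite summxE !mxE /=.
under eq_bigr => Q _ do rewrite mxE.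
have [ijC|ijC] := boolP ((i, j) \in increasing_pairs C); last first.
  rewrite mulr0 big1// => Q QC.
  have /negbTE-> // : (i, j) \notin oriented Q.
  by apply: contraNN ijC; apply: (subsetP (oriented_subset _ _ _ QC)).
have [eC e2] := incrP _ ijC.
rewrite mulr1 /k (card_matchings_with _ _ _ pC' eC p2 e2).
rewrite -sum1_card natr_sum [RHS]big_mkcond [LHS]big_mkcond /=.
apply: eq_bigr => Q _; rewrite [Q \in matchings_with _ _]inE.
have -> : ((i, j) \in oriented Q) = (edge (i, j) \in Q).
  by move: ijC; rewrite !inE /= => /and3P[_ _ ->].
by case: (Q \in matchings C); case: (edge (i, j) \in Q).
Qed.

(** * Dominance *)

(** Halving whichever of b and b - 1 is even bounds the binomial coefficient by
    [b./2 * b]. *)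
Lemma bin2_lt_half_mul (b g : nat) :
  (1 < b)%N -> (b < g)%N -> ('C(b, 2) < b./2 * g)%N.
Proof.
move=> b_gt1 b_lt; have h_gt0 : (0 < b./2)%N by rewrite half_gt0.
have le_half : ('C(b, 2) <= b./2 * b)%N.
  have := odd_double_half b; move: b./2 => h <-.
  case: (odd b); rewrite bin2 /= ?add1n ?add0n /=.
    by rewrite -doubleMr doubleK mulnC.
  by rewrite -doubleMl doubleK leq_mul2l leq_pred orbT.
by apply: leq_ltn_trans le_half _; rewrite ltn_pmul2l.
Qed.

Lemma half_lt_bin2 (b : nat) : (2 < b)%N -> (b./2 < 'C(b, 2))%N.
Proof.
move=> b_gt2; rewrite bin2; have b_eq : b = b.-1.+1 by rewrite prednK// ltnW// ltnW.
have : (b.+2 <= b * b.-1)%N by nia.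
by move=> /half_leq; apply: leq_trans.
Qed.

Lemma increasing_pairs_lt (n : nat) (C : {set 'I_n}) i j :
  (i, j) \in increasing_pairs C -> (i < j)%N.
Proof. by rewrite inE => /and3P[]. Qed.

(** The constant matrix that makes all the inequalities in SCILS tight also makes
    their sum tight, and this sum has the left-hand side of CILS up to scaling
    but a larger right-hand side. *)
Lemma SCILS_not_dominates (R : realType) (n : nat) (C : {set 'I_n})
    (beta : nat) :
    ~~ odd #|C| -> (1 < beta)%N -> (beta < #|C| - 1)%N ->
  ~ dominates (SCILS R C beta) [set CILS R C beta].
Proof.
move=> evenC beta_gt1; rewrite subn1 => beta_lt dom.
have m_gt0 : (0 < #|C|./2)%N.
  by rewrite half_gt0; apply: leq_trans (leq_pred _); apply: ltn_trans beta_lt.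
pose t : R := (beta./2)%:R / (#|C|./2)%:R.
have sumt (P : {set 'I_n * 'I_n}) :
    \sum_(p in P) (const_mx t : 'M[R]_n) p.1 p.2 = t *+ #|P|.
  by under eq_bigr do rewrite mxE; rewrite sumr_const.
have t_half : t *+ #|C|./2 = (beta./2)%:R.
  by rewrite -[t *+ _]mulr_natr divfK// pnatr_eq0 -lt0n.
have : satisfies (const_mx t) (CILS R C beta).
  apply: dom => //; first by rewrite trmx_const.
    by move=> i j; rewrite mxE divr_ge0.
  rewrite SCILS_matchings => _ [Q QC <-].
  by apply/satisfies_pair_ineq; rewrite sumt (card_oriented_matching _ C)// t_half.
move=> /satisfies_pair_ineq; rewrite sumt card_increasing_pairs.
rewrite bin2 -{1}(even_halfK evenC) -doubleMl doubleK mulrnA t_half -mulrnA ler_nat.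
by rewrite leqNgt bin2_lt_half_mul.
Qed.

(** Concentrating the whole right-hand side of CILS on one edge (a, b) of a
    matching violates the inequality of that matching.  For beta = 2 both
    right-hand sides are 1, so the bound on beta is sharp. *)
Lemma CILS_not_dominates (R : realType) (n : nat) (C : {set 'I_n})
    (beta : nat) :
    ~~ odd #|C| -> C != set0 -> (2 < beta)%N ->
  ~ dominates [set CILS R C beta] (SCILS R C beta).
Proof.
move=> evenC C0 beta_gt2 dom.
have [Q QC] := matching_exists C evenC.
have [[a b] abQ] : exists p, p \in oriented Q.
  apply/set0Pn; rewrite -card_gt0 (card_oriented_matching _ C)// half_gt0.
  by move: evenC; rewrite -card_gt0 in C0; case: #|C| C0 => [|[]].
have abC := subsetP (oriented_subset _ _ _ QC) _ abQ.
have lt_ab := increasing_pairs_lt _ _ _ _ abC.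
pose X : 'M[R]_n :=
  \matrix_(i, j) ('C(beta, 2) * (edge (i, j) == edge (a, b)))%:R.
have sumX (P : {set 'I_n * 'I_n}) : (a, b) \in P -> P \subset increasing_pairs C ->
    \sum_(p in P) X p.1 p.2 = ('C(beta, 2))%:R.
  move=> abP /subsetP PC; rewrite (bigD1 (a, b))//= mxE eqxx muln1 big1 ?addr0//.
  move=> [i j] /andP[ijP ij_ab]; rewrite mxE.
  have [/edge_inj eq_ij|] := eqVneq; last by rewrite muln0.
  by rewrite eq_ij ?eqxx ?(increasing_pairs_lt _ _ _ _ (PC _ ijP)) in ij_ab.
have : satisfies X (matching_ineq (beta./2)%:R Q).
  apply: dom; last by rewrite SCILS_matchings; exists Q.
  - by apply/matrixP => i j; rewrite !mxE /edge /= setUC.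
  - by move=> i j; rewrite mxE.
  - by move=> _ ->; apply/satisfies_pair_ineq; rewrite sumX.
move=> /satisfies_pair_ineq; rewrite sumX//; last exact: oriented_subset.
by rewrite ler_nat leqNgt half_lt_bin2.
Qed.

Theorem theorem21 (R : realType) (n : nat) (w : 'cV[int]_n) (c : int)
    (C : {set 'I_n}) (beta : nat)
    (w_gt0 : forall i, 0 < w i 0) (c_gt0 : 0 < c)
    (w_le_c : forall i, w i 0 <= c)
    (beta_gt1 : (1 < beta)%N) (beta_lt : (beta < #|C|)%N)
    (valid : forall x : 'cV[R]_n,
       knapsack_polytope w c x -> \sum_(j in C) x j 0 <= beta%:R)
    (C_even : ~~ odd #|C|) :
  (beta = (#|C| - 1)%N ->
     equivalent (\sum_(q \in SCILS R C beta) q) (CILS R C beta) /\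
     dominates (SCILS R C beta) [set CILS R C beta]) /\
  ((beta < #|C| - 1)%N ->
     ~ dominates (SCILS R C beta) [set CILS R C beta] /\
     ((2 < beta)%N -> no_dominance (SCILS R C beta) [set CILS R C beta])).
Proof.
have C_gt1 : (1 < #|C|)%N by apply: ltn_trans beta_lt.
split=> [betaE|beta_lt1]; last first.
  have not_dom := SCILS_not_dominates R _ _ _ C_even beta_gt1 beta_lt1.
  split=> // beta_gt2; split=> //; apply: CILS_not_dominates => //.
  by rewrite -card_gt0 ltnW.
have [k k_gt0 sumE] := sum_matching_ineq R n C (beta./2)%:R C_even C_gt1.
have rhsE : (beta./2)%:R * (#|C|.-1)%:R = ('C(beta, 2))%:R :> R.
  rewrite -natrM -subn1 -betaE; congr _%:R.
  (* beta is odd, so its half is also the half of beta - 1. *)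
  have odd_beta : odd beta.
    by rewrite betaE subn1; case: #|C| C_gt1 C_even => // g _; rewrite /= negbK.
  by rewrite bin2odd// mulnC -[in RHS](odd_halfK odd_beta) doubleK.
rewrite rhsE -/(CILS R C beta) -sum_SCILS in sumE.
split; first by exists k.
move=> X _ _ satX _ ->; apply/(satisfiesZ _ _ _ _ _ k_gt0); rewrite -sumE sum_SCILS.
by apply: satisfies_sum => Q QC; apply: satX; rewrite SCILS_matchings; exists Q.
Qed.
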